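(* Assume that $F(x,y,z,t)\in\mathbb{C}[x,y,z,t]$ is a non-zero polynomial satisfying the following conditions: (1) $F$ is irreducible and $F\notin\mathbb{C}[z,t]$. (2) The set $\{(z_0,t_0)\in\mathbb{C}^2 : F(x,y,z_0,t_0)\text{ is reducible in }\mathbb{C}[x,y]\}$ is finite. (3) For each $(z_0,t_0)\in\mathbb{C}^2$, the set $\{(z_1,t_1)\in\mathbb{C}^2 : \exists\,\lambda\in\mathbb{C}\text{ such that }F(x,y,z_0,t_0)=\lambda F(x,y,z_1,t_1)\}$ (equality as polynomials in $x,y$) is finite. Then $F$ is non-Cartesian.
   Context: A polynomial $P(x,y,z,t)\in\mathbb{C}[x,y,z,t]$ is called Cartesian if it can be written as $P(x,y,z,t)=G(x,y)F_1(x,y,z,t)+H(z,t)F_2(x,y,z,t)$, where $G\in\mathbb{C}[x,y]$ and $H\in\mathbb{C}[z,t]$ are non-constant polynomials and $F_1,F_2\in\mathbb{C}[x,y,z,t]$ are arbitrary. It is non-Cartesian if it is not Cartesian. *)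

(* Defs.v *)
From HB Require Import structures.
From mathcomp Require Import all_boot all_order all_algebra.
From mathcomp Require Import classical_sets cardinality reals.
From mathcomp Require Import complex mpoly.

Set Implicit Arguments.
Unset Strict Implicit.
Unset Printing Implicit Defensive.

Import GRing.Theory.

Local Open Scope ring_scope.

Section Definitions.
Variable K : comNzRingType.

Definition constant_mpoly (n : nat) (p : {mpoly K[n]}) : Prop :=
  exists c : K, p = c%:MP.

(* These two predicates are meant for K a field, where the non-zero constants
   are exactly the units. Constant polynomials, 0 included, are then neither
   reducible nor irreducible. *)
Definition reducible_mpoly (n : nat) (p : {mpoly K[n]}) : Prop :=
  exists q r : {mpoly K[n]},
    [/\ p = q * r, ~ constant_mpoly q & ~ constant_mpoly r].

Definition irreducible_mpoly (n : nat) (p : {mpoly K[n]}) : Prop :=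
  ~ constant_mpoly p /\ ~ reducible_mpoly p.

(* The variables x, y, z, t of K[x,y,z,t] are 'X_0, 'X_1, 'X_2, 'X_3. *)
Definition varx : {mpoly K[4]} := 'X_(inord 0).
Definition vary : {mpoly K[4]} := 'X_(inord 1).
Definition varz : {mpoly K[4]} := 'X_(inord 2).
Definition vart : {mpoly K[4]} := 'X_(inord 3).

(* The inclusions of K[x,y] and of K[z,t] into K[x,y,z,t]; both subrings are
   represented by {mpoly K[2]}. *)
Definition of_xy (G : {mpoly K[2]}) : {mpoly K[4]} :=
  G \mPo [tuple varx; vary].
Definition of_zt (H : {mpoly K[2]}) : {mpoly K[4]} :=
  H \mPo [tuple varz; vart].

(* F(x,y,z0,t0) as an element of K[x,y], where u = (z0,t0). *)
Definition specialize_zt (F : {mpoly K[4]}) (u : K * K) : {mpoly K[2]} :=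
  F \mPo [tuple 'X_(inord 0); 'X_(inord 1); u.1%:MP; u.2%:MP].

Definition cartesian (P : {mpoly K[4]}) : Prop :=
  exists (G H : {mpoly K[2]}) (F1 F2 : {mpoly K[4]}),
    [/\ ~ constant_mpoly G, ~ constant_mpoly H
      & P = of_xy G * F1 + of_zt H * F2].

End Definitions.

(* Main.v *)
Require Import Defs.
From HB Require Import structures.
From mathcomp Require Import all_boot all_order all_algebra.
From mathcomp Require Import boolp classical_sets cardinality reals.
From mathcomp Require Import complex mpoly.

(** Suppose [F = G F1 + H F2]. For the infinitely many [u] on the curve [H = 0],
    [F(.,u) = G F1(.,u)]; by (2), for all but finitely many of them the factor
    [F1(.,u)] is a constant, so [F(.,u)] is a multiple of the fixed polynomial
    [G]. Infinitely many specializations are therefore proportional to each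
    other, contradicting (3). *)

Local Open Scope classical_set_scope.
Local Open Scope ring_scope.

Import GRing.Theory.

(** The polynomial [r * 'X + 1] is non-constant, so it has a root [a]; there [r.[a] * a = -1], which
    forces [r.[a]] to be non-zero. *)
Lemma closed_field_nonroot (K : closedFieldType) (r : {poly K}) :
  r != 0 -> exists a, ~~ root r a.
Proof.
move=> r0; have s_r : size (r * 'X + 1%:P) != 1%N.
  by rewrite -cons_poly_def size_cons_poly nil_poly (negPf r0) /= eqSS size_poly_eq0.
have /closed_rootP [a] := s_r.
rewrite /root !hornerE => /eqP ra; exists a; apply: contraFN (oner_eq0 K).
by move=> /eqP r_a; rewrite -ra r_a mul0r add0r.
Qed.

Lemma closed_field_nonroot_notin (K : closedFieldType) (r : {poly K})
    (s : seq K) : r != 0 -> exists2 a, a \notin s & ~~ root r a.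
Proof.
(* The linear factors turn avoidance of [s] into a non-root condition. *)
move=> r0; have [|a] := closed_field_nonroot K (r * \prod_(b <- s) ('X - b%:P)).
  by rewrite mulf_neq0 // monic_neq0 // monic_prod_XsubC.
by rewrite rootM root_prod_XsubC negb_or => /andP[ra sa]; exists a.
Qed.

Section Bivariate.
Variable K : comNzRingType.

(** The isomorphism from [K[x,y]] to [K[x][y]]: [x] becomes the inner indeterminate and [y] the
    outer one. *)
Definition iterated_poly : {mpoly K[2]} -> {poly {poly K}} :=
  mmap (polyC \o polyC) (fun i : 'I_2 => if val i == 0%N then 'X%:P else 'X).

Lemma horner_iterated_poly (H : {mpoly K[2]}) (a b : K) :
  (map_poly (horner_eval a) (iterated_poly H)).[b]
  = H.@[tnth [tuple a; b]].
Proof.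
pose ev : {rmorphism {poly {poly K}} -> {poly K}} := map_poly (horner_eval a).
rewrite -[map_poly _ _]/(ev _) /iterated_poly /meval /mmap rmorph_sum horner_sum.
apply: eq_bigr => m _; rewrite rmorphM hornerM {1}/ev /= map_polyC hornerC /=.
rewrite [horner_eval _ _]hornerC; congr (_ * _).
rewrite -[map_poly _ _]/(ev _) /mmap1 rmorph_prod horner_prod.
apply: eq_bigr => i _; rewrite rmorphXn horner_exp; congr (_ ^+ _).
rewrite {}/ev (tnth_nth 0); case: i => [[|[|//]] i2] /=.
  by rewrite map_polyC hornerC; apply: hornerX.
by rewrite map_polyX hornerX.
Qed.

(** Evaluation at the two variables, [ev] below, is a left inverse of [iterated_poly] and preserves
    constants. *)
Lemma iterated_poly_constant (H : {mpoly K[2]}) (c : K) :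
  iterated_poly H = c%:P%:P -> H = c%:MP.
Proof.
pose ev1 : {rmorphism {poly K} -> {mpoly K[2]}} :=
  horner_morph (fun a => mulrC ('X_ord0 : {mpoly K[2]}) (@mpolyC 2 K a)).
pose ev : {rmorphism {poly {poly K}} -> {mpoly K[2]}} :=
  horner_morph (fun a => mulrC ('X_ord_max : {mpoly K[2]}) (ev1 a)).
have evC a : ev a%:P%:P = a%:MP by rewrite /= horner_morphC /= horner_morphC.
move=> /(congr1 ev); rewrite evC => <-.
rewrite [LHS]mpolyE /iterated_poly /mmap rmorph_sum; apply: eq_bigr => m _.
rewrite rmorphM /= -[horner_morph _ _]/(ev _) evC mul_mpolyC; congr (_ *: _).
rewrite -[horner_morph _ _]/(ev _) mpolyXE_id /mmap1 rmorph_prod.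
apply: eq_bigr => i _; rewrite rmorphXn; congr (_ ^+ _).
case: i => [[|[|//]] i2] /=; rewrite ?horner_morphX ?horner_morphC /= ?horner_morphX;
  by congr 'X_ _; apply: val_inj.
Qed.

End Bivariate.

(** One coordinate is chosen outside the finitely many values it takes on [s]; the other is a root
    of a univariate polynomial. *)
Lemma plane_curve_infinite (K : closedFieldType) (H : {mpoly K[2]})
    (s : seq (K * K)) :
  ~ constant_mpoly H ->
  exists2 u, u \notin s & H.@[tnth [tuple u.1; u.2]] = 0.
Proof.
move=> Hnc; pose p := iterated_poly K H.
have [p_le1|p_gt1] := leqP (size p) 1.
  (* Here [H] lies in [K[x]]: [a] is a root of [c], and the free coordinate [b] avoids [s]. The case
     [c = 0], of size 0, also falls under the root case. *)
  pose c := p`_0; have pE : p = c%:P by apply: size1_polyC.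
  have [/closed_rootP[a /eqP ca]|] := boolP (size c != 1%N); last first.
    rewrite negbK => /eqP c1; case: Hnc; exists c`_0.
    by apply: iterated_poly_constant; rewrite -size1_polyC ?c1.
  have [b sb _] := closed_field_nonroot_notin K 1 [seq u.2 | u <- s] (oner_neq0 _).
  exists (a, b); first by apply: contra sb => /(map_f snd).
  by rewrite -horner_iterated_poly -/p pE map_polyC hornerC /horner_eval.
(* Here [H] has positive degree in [y]. If [a] is not a root of the leading coefficient, [H(a,y)]
   keeps that degree and has a root [b]. *)
have lp0 : lead_coef p != 0.
  by rewrite lead_coef_eq0 -size_poly_gt0 (ltn_trans _ p_gt1).
have [a sa pa] := closed_field_nonroot_notin K _ [seq u.1 | u <- s] lp0.
have /closed_rootP[b /eqP pb] : size (map_poly (horner_eval a) p) != 1%N.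
  by rewrite size_poly_eq ?gtn_eqF.
exists (a, b); first by apply: contra sa => /(map_f fst).
by rewrite -horner_iterated_poly.
Qed.

Section Specialization.
Variable K : comNzRingType.

Lemma comp_mpolyA (k l n : nat) (p : {mpoly K[k]})
    (lp : k.-tuple {mpoly K[l]}) (lq : l.-tuple {mpoly K[n]}) :
  (p \mPo lp) \mPo lq = p \mPo map_tuple (fun q => q \mPo lq) lp.
Proof.
rewrite !(comp_mpolyEX p) raddf_sum /=; apply: eq_bigr => m _.
rewrite comp_mpolyZ !comp_mpolyX rmorph_prod /=; congr (_ *: _).
by apply: eq_bigr => i _; rewrite rmorphXn tnth_map.
Qed.

Lemma specialize_of_xy (G : {mpoly K[2]}) (u : K * K) :
  specialize_zt (of_xy G) u = G.
Proof.
rewrite /specialize_zt /of_xy comp_mpolyA -[RHS]comp_mpoly_id.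
congr (_ \mPo _); apply: eq_from_tnth => i; rewrite tnth_map tnth_mktuple.
by case: i => [[|[|//]] i2]; rewrite !(tnth_nth 0) /= comp_mpolyXU inordK //=;
  congr 'X_ _; apply: val_inj; rewrite /= inordK.
Qed.

Lemma specialize_of_zt (H : {mpoly K[2]}) (u : K * K) :
  specialize_zt (of_zt H) u = (H.@[tnth [tuple u.1; u.2]])%:MP.
Proof.
rewrite /specialize_zt /of_zt comp_mpolyA comp_mpolyEX mevalE raddf_sum /=.
apply: eq_bigr => m _; rewrite comp_mpolyX rmorphM rmorph_prod /= mul_mpolyC.
congr (_ *: _); apply: eq_bigr => i _; rewrite rmorphXn; congr (_ ^+ _).
rewrite tnth_map.
by case: i => [[|[|//]] i2]; rewrite !(tnth_nth 0) /= comp_mpolyXU inordK.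
Qed.

Lemma specialize_cartesian (G H : {mpoly K[2]}) (F1 F2 : {mpoly K[4]}) u :
  H.@[tnth [tuple u.1; u.2]] = 0 ->
  specialize_zt (of_xy G * F1 + of_zt H * F2) u = G * specialize_zt F1 u.
Proof.
move=> Hu; rewrite /specialize_zt rmorphD !rmorphM /=.
by rewrite -!/(specialize_zt _ u) specialize_of_xy specialize_of_zt Hu mul0r addr0.
Qed.

End Specialization.

Theorem theorem3p1 (R : realType) (F : {mpoly (complex R)[4]})
  (F_neq0 : F != 0)
  (F_irreducible : irreducible_mpoly F)
  (F_notin_zt : ~ exists H : {mpoly (complex R)[2]}, F = of_zt H)
  (reducible_finite :
    finite_set [set u : complex R * complex R |
                  reducible_mpoly (specialize_zt F u)])
  (proportional_finite : forall u0 : complex R * complex R,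
    finite_set [set u1 : complex R * complex R |
                  exists lambda : complex R,
                    specialize_zt F u0 = lambda *: specialize_zt F u1]) :
  ~ cartesian F.
Proof.
move=> [G [H [F1 [F2 [Gnc Hnc FE]]]]].
have [red redE] := (finite_seqP _).1 reducible_finite.
have FG u : u \notin red -> H.@[tnth [tuple u.1; u.2]] = 0 ->
    exists c, specialize_zt F u = c *: G.
  move=> u_red Hu; have Fu : specialize_zt F u = G * specialize_zt F1 u.
    by rewrite FE; apply: specialize_cartesian.
  (* If [F(.,u)] is not a multiple of [G], the cofactor [F1(.,u)] is non-constant, so [F(.,u)] is
     reducible and [u] lies in [red]. *)
  apply: contrapT => Fu_nc; apply: (negP u_red).
  have : [set u | reducible_mpoly (specialize_zt F u)] u.
    exists G, (specialize_zt F1 u); split=> // -[c F1u]; apply: Fu_nc.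
    by exists c; rewrite Fu F1u mulrC mul_mpolyC.
  by rewrite redE.
have [u0 u0_red Hu0] := plane_curve_infinite _ H red Hnc.
have [c0 Fu0] := FG _ u0_red Hu0.
have [prop propE] := (finite_seqP _).1 (proportional_finite u0).
(* Avoiding [red] makes [F(.,u1)] a multiple of [G]; avoiding [prop] forbids its proportionality to
   [F(.,u0)]. *)
have [u1] := plane_curve_infinite _ H (red ++ prop) Hnc.
rewrite mem_cat negb_or => /andP[u1_red u1_prop] Hu1.
have [c1 Fu1] := FG _ u1_red Hu1.
(* The ratio [c0 / c1] requires only [c1] to be non-zero; [c0] may vanish. *)
have [c1_0|c1_neq0] := eqVneq c1 0; last first.
  apply: (negP u1_prop).
  have : [set u1 | exists lambda,
             specialize_zt F u0 = lambda *: specialize_zt F u1] u1.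
    by exists (c0 / c1); rewrite Fu0 Fu1 scalerA divfK.
  by rewrite propE.
(* [F(.,u1) = 0] is [0 *: F(.,u)] for every [u]. *)
have [all allE] := (finite_seqP _).1 (proportional_finite u1).
have [u u_all _] := plane_curve_infinite _ H all Hnc.
apply: (negP u_all).
have : [set u | exists lambda,
           specialize_zt F u1 = lambda *: specialize_zt F u] u.
  by exists 0; rewrite Fu1 c1_0 !scale0r.
by rewrite allE.
Qed.
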